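(* Let $\mathfrak X$ be a real separable Fréchet space, with topology generated by an increasing sequence of seminorms $(p_k)_{k\in\mathbb N}$, that admits a Schauder basis $(e_k)_{k\in\mathbb N}$, and let $\sigma:\mathfrak X\to\mathfrak X$ satisfy: there exists $k_0\in\mathbb N$ such that for all $k\ge k_0$ there exists $C_k\ge0$ with $$p_k(\sigma(x)-\sigma(y))\le C_k\,p_k(x-y),\quad x,y\in\mathfrak X.$$ Let $f\in C(\mathfrak X;\mathbb R)$, $K\subset\mathfrak X$ compact and $\varepsilon>0$. Assume $$\mathcal N^{\varepsilon}(x)=\sum_{j=1}^M\langle\ell_j,\sigma(A_jx+b_j)\rangle,\quad x\in\mathfrak X,$$ with $\ell_j\in\mathfrak X'$, $A_j\in\mathcal L(\mathfrak X)$ and $b_j\in\mathfrak X$ such that $$\sup_{x\in K}|f(x)-\mathcal N^{\varepsilon}(x)|<\varepsilon.$$ Fix $\delta>0$. Then there exists $N_*=N_*(\mathcal N^{\varepsilon},\delta)\in\mathbb N$ such that for $N\ge N_*$ $$\sup_{x\in K}\Big|f(x)-\sum_{j=1}^M\langle\ell_j\circ\Pi_N,\sigma(\Pi_NA_j\Pi_Nx+\Pi_Nb_j)\rangle\Big|<\varepsilon+\delta.$$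
   Context: $\mathfrak X'$ is the topological dual of $\mathfrak X$, $\langle\cdot,\cdot\rangle$ the canonical pairing between $\mathfrak X'$ and $\mathfrak X$, $\mathcal L(\mathfrak X)$ the space of continuous linear operators $\mathfrak X\to\mathfrak X$, and $C(\mathfrak X;\mathbb R)$ the space of continuous real-valued functions on $\mathfrak X$. A Schauder basis of $\mathfrak X$ is a sequence $(e_k)_{k\in\mathbb N}\subset\mathfrak X$ such that each $x\in\mathfrak X$ has a unique representation $x=\sum_{k=1}^\infty x_ke_k$ with scalars $x_k$ (convergence in $\mathfrak X$). For $N\in\mathbb N$, $\Pi_N:\mathfrak X\to\operatorname{span}\{e_1,\dots,e_N\}$ is the projection $x\mapsto\sum_{k=1}^Nx_ke_k$. *)

(* Defs.v *)
From HB Require Import structures.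
From mathcomp Require Import all_boot all_order all_algebra.
From mathcomp Require Import all_classical all_reals all_analysis.

Set Implicit Arguments.
Unset Strict Implicit.
Unset Printing Implicit Defensive.

Import Order.TTheory GRing.Theory Num.Theory.
Import numFieldNormedType.Exports.

Local Open Scope classical_set_scope.
Local Open Scope ring_scope.

Section Frechet.
Context {R : realType} {X : tvsType R}.

Definition seminorm (q : X -> R) : Prop :=
  (forall x y, q (x + y) <= q x + q y) /\
  (forall (a : R) x, q (a *: x) = `|a| * q x).

(* The sets {y | p_k (y - x) < r for all k <= n}, n : nat and r > 0, form a
   neighbourhood base at x. *)
Definition generates_topology (p : nat -> X -> R) : Prop :=
  forall (x : X) (U : set X), nbhs x U <->
    exists n r, 0 < r /\
      [set y | forall k, (k <= n)%N -> p k (y - x) < r] `<=` U.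

(* In a [tvsType] the entourages are compatible with the topology but need not
   be translation invariant, so the library's [cauchy] is not the usual notion
   for topological vector spaces. *)
Definition tvs_cauchy (u : X ^nat) : Prop :=
  forall U : set X, nbhs 0 U ->
    exists n0, forall m n, (n0 <= m)%N -> (n0 <= n)%N -> U (u m - u n).

(* Completeness is sequential, which suffices because the topology is
   metrizable. *)
Record frechet_space : Prop := FrechetSpace {
  frechet_hausdorff : hausdorff_space X ;
  frechet_seminorms : exists q : nat -> X -> R,
    (forall k, seminorm (q k)) /\ generates_topology q ;
  frechet_complete : forall u : X ^nat, tvs_cauchy u ->
    exists x : X, u @ \oo --> x
}.

Definition separable : Prop := exists2 D : set X, countable D & dense D.

Definition expands (e : nat -> X) (x : X) (a : nat -> R) : Prop :=
  series (fun k => a k *: e k) @ \oo --> x.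

Definition schauder_basis (e : nat -> X) : Prop :=
  forall x, exists! a : nat -> R, expands e x a.

(* Meaningful when e is a Schauder basis; [get] returns an arbitrary sequence
   if x has no expansion. *)
Definition coordinates (e : nat -> X) (x : X) : nat -> R :=
  get [set a | expands e x a].

(* The basis is indexed from 0: the N-th projection keeps the terms of index
   0, ..., N - 1. *)
Definition basis_proj (e : nat -> X) (N : nat) (x : X) : X :=
  \sum_(k < N) coordinates e x k *: e k.

End Frechet.

Arguments frechet_space {R} X.
Arguments separable {R} X.

(* Main.v *)
(* The projections Pi_N are equicontinuous: the seminorms
   q_n x = sup_N p_n (Pi_N x) dominate p_n and make X complete, so by the
   open mapping argument (Baire, then summing geometric approximations of x by
   vectors y_i with q_(n+i) y_i <= 2^-i) each q_n is continuous on X.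
   Equicontinuity and Pi_N x --> x give Pi_N y --> x jointly as
   (N, y) --> (oo, x); this joint convergence is stable under composition with
   the continuous maps A_j, sigma and l_j, and on a compact set it is uniform. *)

Require Import Defs.
From mathcomp Require Import all_boot all_order all_algebra.
From mathcomp Require Import all_classical all_reals all_analysis.
From mathcomp Require Import lra ring.
Import Order.TTheory GRing.Theory Num.Theory.
Import numFieldNormedType.Exports.
Local Open Scope classical_set_scope.
Local Open Scope ring_scope.

Set Implicit Arguments.
Unset Strict Implicit.

(** * Topology defined by an increasing sequence of seminorms *)

Section Seminorms.
Context {R : realType} {X : tvsType R}.

Section OneSeminorm.
Context {q : X -> R}.
Hypothesis qS : seminorm q.

Lemma seminormD x y : q (x + y) <= q x + q y.
Proof. exact: qS.1. Qed.

Lemma seminormZ a x : q (a *: x) = `|a| * q x.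
Proof. exact: qS.2. Qed.

Lemma seminorm0 : q 0 = 0.
Proof. by rewrite -(scale0r (0 : X)) seminormZ normr0 mul0r. Qed.

Lemma seminormN x : q (- x) = q x.
Proof. by rewrite -scaleN1r seminormZ normrN1 mul1r. Qed.

Lemma seminormB x y : q (x - y) <= q x + q y.
Proof. by rewrite -(seminormN y) seminormD. Qed.

Lemma seminormBC x y : q (x - y) = q (y - x).
Proof. by rewrite -seminormN opprB. Qed.

Lemma seminorm_ge0 x : 0 <= q x.
Proof. by have := seminormB x x; rewrite subrr seminorm0; lra. Qed.

Lemma seminorm_dist y x z : q (x - z) <= q (x - y) + q (y - z).
Proof. by have := seminormD (x - y) (y - z); rewrite addrA subrK. Qed.

End OneSeminorm.

Context {p : nat -> X -> R}.
Hypotheses (pS : forall k, seminorm (p k))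
           (p_incr : forall k x, p k x <= p k.+1 x)
           (pG : generates_topology p).

Lemma seminorms_mono m n x : (m <= n)%N -> p m x <= p n x.
Proof.
move=> /subnKC <-; elim: (n - m)%N => [|d IH]; first by rewrite addn0.
by rewrite addnS (le_trans IH).
Qed.

(** As the seminorms increase, the one of highest index controls all earlier ones, so a single ball
    replaces the finite intersection. *)
Lemma nbhs_seminormsP (x : X) (U : set X) :
  nbhs x U <-> exists n r, 0 < r /\ [set y | p n (y - x) < r] `<=` U.
Proof.
split=> [/(pG x U)[n [r [r0 sub]]]|[n [r [r0 sub]]]].
  exists n, r; split=> // y /= yr; apply: sub => k kn /=.
  exact: le_lt_trans (seminorms_mono _ kn) yr.
by apply/(pG x U); exists n, r; split=> // y /= /(_ n (leqnn n)); exact: sub.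
Qed.

Lemma cvg_seminormsP {T : Type} {F : set_system T} {FF : Filter F}
    (u : T -> X) (x : X) :
  u @ F --> x <-> forall n eps, 0 < eps -> \forall i \near F, p n (u i - x) < eps.
Proof.
split=> [ux n eps eps0|ux U /nbhs_seminormsP[n [r [r0 sub]]]].
  by apply: (ux [set y | p n (y - x) < eps]); apply/nbhs_seminormsP; exists n, eps; split.
by near=> i; apply: sub; near: i; exact: ux.
Unshelve. all: by end_near. Qed.

Lemma cvg_seminorm_le {T : Type} {F : set_system T} {FF : ProperFilter F}
    {u : T -> X} {x y : X} {n : nat} {c : R} :
  u @ F --> x -> (\forall i \near F, p n (u i - y) <= c) -> p n (x - y) <= c.
Proof.
move=> /cvg_seminormsP ux uc; apply/ler_addgt0Pr => eps eps0.
have [i [uic uix]] :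
    exists i, p n (u i - y) <= c /\ p n (u i - x) < eps.
  by apply: (@filter_ex _ F); apply: filterI => //; exact: ux.
have := seminorm_dist (pS n) (u i) x y.
by rewrite (seminormBC (pS n) x (u i)); lra.
Qed.

Lemma seminorms_tvs_cauchy (u : X ^nat) :
  (forall n eps, 0 < eps ->
     exists i, forall j, (i <= j)%N -> p n (u j - u i) < eps) ->
  tvs_cauchy u.
Proof.
move=> uC U /nbhs_seminormsP[n [r [r0 sub]]].
have [i iP] := uC n (r / 2) ltac:(lra).
exists i => a c ia ic; apply: sub => /=; rewrite subr0.
have := seminorm_dist (pS n) (u i) (u a) (u c).
by rewrite (seminormBC (pS n) (u i) (u c)); have := iP _ ia; have := iP _ ic; lra.
Qed.

Lemma seminorm_lipschitz_continuous (sigma : X -> X) :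
  (exists k0, forall k, (k0 <= k)%N ->
     exists C : R, 0 <= C /\
       forall x y, p k (sigma x - sigma y) <= C * p k (x - y)) ->
  continuous sigma.
Proof.
move=> [k0 sigmaL] x; apply/cvg_seminormsP => n eps eps0.
have [C [C0 CL]] := sigmaL _ (leq_maxl k0 n).
have xx : y @[y --> x] --> x by exact: cvg_id.
(* The radius will be [eps / (C + 1)], which makes sense even when [C = 0]. *)
have C1 : 0 < C + 1 by lra.
move/cvg_seminormsP : xx => /(_ (maxn k0 n) _ (divr_gt0 eps0 C1)).
apply: filterS => y; rewrite ltr_pdivlMr // => yx.
apply: le_lt_trans (seminorms_mono _ (leq_maxr k0 n)) _.
apply: le_lt_trans (CL _ _) _; have := seminorm_ge0 (pS (maxn k0 n)) (y - x).
lra.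
Qed.

(** * A Baire category argument with geometrically shrinking balls *)

Lemma half_expr_small (eps : R) : 0 < eps -> exists i : nat, 2^-1 ^+ i < eps.
Proof.
move=> eps0; apply: (@filter_ex _ (nbhs \oo)).
have /cvgrPdist_lt/(_ _ eps0) : (2^-1 : R) ^+ n @[n --> \oo] --> (0 : R).
  by apply: cvg_expr; rewrite ger0_norm; lra.
by apply: filterS => i; rewrite sub0r normrN; apply: le_lt_trans; exact: ler_norm.
Qed.

Hypothesis X_complete : forall u : X ^nat, tvs_cauchy u -> exists x : X, u @ \oo --> x.

(** Otherwise every ball contains, for each j, a smaller closed ball that misses [F j]. Doing this
    for j = 0, 1, ... in turn gives nested balls whose centres converge, by completeness, to a point
    in no [F j]. *)
Lemma baire_seminorms (F : nat -> set X) :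
  (forall x, exists j, F j x) ->
  exists j x0 m r, 0 < r /\ forall y, p m (y - x0) < r ->
    forall m' eps, 0 < eps -> exists2 z, F j z & p m' (z - y) < eps.
Proof.
move=> Fcover; apply: contrapT => nobase.
(* A ball is coded as (centre, seminorm index, radius). The guard [0 < r] makes the step total, so
   that [choice] applies; for other radii the ball is returned unchanged. *)
have step (js : nat * (X * nat * R)) : exists t : X * nat * R,
    let: (j, (x, m, r)) := js in let: (x', m', r') := t in
    0 < r -> [/\ 0 < r', r' <= r / 2, (m < m')%N, p m (x' - x) < r / 2
              & forall z, p m' (z - x') <= r' -> ~ F j z].
  case: js => j [[x m] r]; case: (ltP 0 r) => [r0|_]; last by exists (x, m, r).
  apply: contrapT => nostep; apply: nobase.
  exists j, x, m, (r / 2); split; first lra.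
  move=> y yx m' eps eps0; apply: contrapT => noz; apply: nostep.
  (* [eps / 2] puts the closed ball inside the open [eps]-ball free of [F j]; [r / 2] halves the
     radius; [m.+1] forces the index to grow, so that every seminorm is eventually controlled. *)
  exists (y, maxn m' m.+1, Num.min (eps / 2) (r / 2)) => _.
  have [min1 min2] : Num.min (eps / 2) (r / 2) <= eps / 2 /\
                     Num.min (eps / 2) (r / 2) <= r / 2.
    by rewrite !ge_min !lexx orbT.
  split=> //; first by rewrite lt_min; apply/andP; split; lra.
    by rewrite leq_maxr.
  move=> z zy Fz; apply: noz; exists z => //.
  by have := @seminorms_mono m' _ (z - y) (leq_maxl _ m.+1); lra.
have [g gP] := choice step.
pose s := fix s (i : nat) : X * nat * R :=
  if i is i'.+1 then g (i', s i') else (0, 0%N, 1).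
pose u i := (s i).1.1; pose m i := (s i).1.2; pose r i := (s i).2.
have sS i : 0 < r i -> [/\ 0 < r i.+1, r i.+1 <= r i / 2, (m i < m i.+1)%N,
    p (m i) (u i.+1 - u i) < r i / 2
  & forall z, p (m i.+1) (z - u i.+1) <= r i.+1 -> ~ F i z].
  rewrite /u /m /r /=; have := gP (i, s i).
  by case: (s i) => -[a b] c /=; case: (g _) => -[a' b'] c' /=.
have r0 i : 0 < r i by elim: i => [|i /sS[]//]; rewrite /r /=.
have rE i : r i <= 2^-1 ^+ i.
  elim: i => [|i IH]; first by rewrite expr0 /r.
  by have [_ h _ _ _] := sS i (r0 i); rewrite exprS; lra.
have mge i : (i <= m i)%N.
  elim: i => [//|i IH]; have [_ _ h _ _] := sS i (r0 i).
  exact: leq_ltn_trans h.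
(* The next centre is within [r i / 2], and all later ones stay within [r i.+1 <= r i / 2] of it. *)
have ball i j : (i <= j)%N -> p (m i) (u j - u i) < r i.
  move=> /subnKC <-; move: (j - i)%N => d; elim: d i => [|d IH] i.
    by rewrite addn0 subrr (seminorm0 (pS _)).
  have [_ h1 h2 h3 _] := sS i (r0 i).
  have := seminorm_dist (pS (m i)) (u i.+1) (u (i + d.+1)%N) (u i).
  have := IH i.+1; rewrite addSnnS.
  by have := @seminorms_mono _ _ (u (i + d.+1)%N - u i.+1) (ltnW h2); lra.
have [z uz] : exists z : X, u @ \oo --> z.
  apply: X_complete; apply: (seminorms_tvs_cauchy (u := u)) => n eps eps0.
  have [i iP] := half_expr_small eps0; exists (maxn n i) => j ij.
  apply: le_lt_trans (seminorms_mono _ (leq_trans (leq_maxl n i) (mge _))) _.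
  apply: lt_le_trans (ball _ _ ij) (le_trans (rE _) (le_trans _ (ltW iP))).
  by apply: ler_wiXn2l; rewrite ?leq_maxr//; lra.
have [j Fj] := Fcover z.
(* The limit lies in the closed ball of index [j.+1], which was chosen to avoid [F j]. *)
have [_ _ _ _ /(_ z)] := sS j (r0 j); apply=> //.
apply: (cvg_seminorm_le uz); exists j.+1 => // i /= ji.
exact: ltW (ball _ _ ji).
Qed.

End Seminorms.

(** * Linearity and pointwise convergence of the basis projections *)

Section SchauderBasis.
Context {R : realType} {X : tvsType R} {p : nat -> X -> R} {e : nat -> X}.
Hypotheses (pS : forall k, seminorm (p k))
           (p_incr : forall k x, p k x <= p k.+1 x)
           (pG : generates_topology p)
           (X_complete : forall u : X ^nat, tvs_cauchy u ->
              exists x : X, u @ \oo --> x)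
           (eB : schauder_basis e).

Lemma expands_coordinates x : expands e x (coordinates e x).
Proof.
by have [a [xa _]] := eB x; rewrite /coordinates; apply: getPex; exists a.
Qed.

Lemma coordinates_unique x a : expands e x a -> coordinates e x = a.
Proof.
have [a' [_ a'_uniq]] := eB x => xa.
by rewrite -(a'_uniq _ xa) (a'_uniq _ (@expands_coordinates x)).
Qed.

Lemma expands_linear c x y a a' : expands e x a -> expands e y a' ->
  expands e (c *: x + y) (fun k => c * a k + a' k).
Proof.
move=> /(cvg_seminormsP p_incr pG) xa /(cvg_seminormsP p_incr pG) ya'.
apply/(cvg_seminormsP p_incr pG) => n eps eps0.
have c1 : 0 < `|c| + 1 by rewrite ltr_wpDl.
have d0 : 0 < eps / 2 / (`|c| + 1) by rewrite !divr_gt0.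
near=> N.
have -> : series (fun k => (c * a k + a' k) *: e k) N =
    c *: series (fun k => a k *: e k) N + series (fun k => a' k *: e k) N.
  rewrite /series /= scaler_sumr -big_split /=; apply: eq_bigr => k _.
  by rewrite scalerDl scalerA.
rewrite opprD addrACA -scalerBr.
apply: (le_lt_trans (seminormD (pS n) _ _)); rewrite (seminormZ (pS n)).
have h1 : p n (series (fun k => a k *: e k) N - x) < eps / 2 / (`|c| + 1).
  by near: N; exact: xa.
have h2 : p n (series (fun k => a' k *: e k) N - y) < eps / 2.
  by near: N; apply: ya'; lra.
move: h1; rewrite ltr_pdivlMr // => h1.
have := seminorm_ge0 (pS n) (series (fun k => a k *: e k) N - x).
lra.
Unshelve. all: by end_near. Qed.

Lemma coordinates_linear c x y k :
  coordinates e (c *: x + y) k = c * coordinates e x k + coordinates e y k.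
Proof.
rewrite (@coordinates_unique _ (fun k => c * coordinates e x k + coordinates e y k)) //.
by apply: expands_linear; exact: expands_coordinates.
Qed.

Lemma basis_proj_linear N c x y :
  basis_proj e N (c *: x + y) = c *: basis_proj e N x + basis_proj e N y.
Proof.
rewrite /basis_proj scaler_sumr -big_split /=; apply: eq_bigr => k _.
by rewrite coordinates_linear scalerDl scalerA.
Qed.

Lemma basis_projD N x y :
  basis_proj e N (x + y) = basis_proj e N x + basis_proj e N y.
Proof. by have := basis_proj_linear N 1 x y; rewrite !scale1r. Qed.

Lemma basis_projB N x y :
  basis_proj e N (x - y) = basis_proj e N x - basis_proj e N y.
Proof. by rewrite -(scaleN1r y) [x + _]addrC basis_proj_linear scaleN1r addrC. Qed.

Lemma basis_proj0 N : basis_proj e N 0 = 0.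
Proof. by have := basis_projB N 0 0; rewrite !subrr. Qed.

Lemma basis_projZ N c x : basis_proj e N (c *: x) = c *: basis_proj e N x.
Proof. by rewrite -[c *: x]addr0 basis_proj_linear basis_proj0 addr0. Qed.

Lemma series_basisE (a : nat -> R) :
  series (fun k => a k *: e k) = (fun N : nat => \sum_(k < N) a k *: e k).
Proof. by apply/funext => N; rewrite /series /= big_mkord. Qed.

Lemma basis_proj_cvg_pointwise x : basis_proj e N x @[N --> \oo] --> x.
Proof. by have := @expands_coordinates x; rewrite /expands series_basisE. Qed.

(** If all seminorms vanished on [e k], every multiple of [e k] would expand 0, against uniqueness.
    This later allows a coordinate to be bounded by a seminorm of its term. *)
Lemma basis_vector_seminorm_gt0 k : exists n, 0 < p n (e k).
Proof.
apply: contrapT => e0.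
have pe0 n : p n (e k) = 0.
  apply/eqP; rewrite eq_le (seminorm_ge0 (pS n)) andbT leNgt; apply/negP => en.
  by apply: e0; exists n.
have exp0 c : expands e 0 (fun i => if i == k then c else 0).
  apply/(cvg_seminormsP p_incr pG) => n eps eps0; apply: nearW => N.
  apply: le_lt_trans eps0; rewrite subr0 series_basisE.
  elim/big_ind : _ => [|x y x0 y0|i _]; first by rewrite (seminorm0 (pS n)).
    by apply: (le_trans (seminormD (pS n) _ _)); lra.
  rewrite (seminormZ (pS n)).
  by case: eqP => [->|_]; rewrite ?pe0 ?mulr0 ?normr0 ?mul0r.
have := coordinates_unique (exp0 1); rewrite (coordinates_unique (exp0 0)).
by move=> /(congr1 (@^~ k)); rewrite eqxx => /eqP; rewrite eq_sym oner_eq0.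
Qed.

(** * Equicontinuity of the projections by the open mapping argument *)

(** A convergent sequence is bounded. The bound is a natural number so that the sublevel sets form a
    countable cover for the Baire argument. *)
Lemma basis_proj_bounded n x : exists j : nat, forall N, p n (basis_proj e N x) <= j%:R.
Proof.
have /(cvg_seminormsP p_incr pG)/(_ n 1 ltr01) [N0 _ N0P] :=
  @basis_proj_cvg_pointwise x.
(* The sum covers the indices below [N0]; from [N0] on the projection is within 1 of [x]. *)
pose B := \sum_(N < N0) p n (basis_proj e N x) + (p n x + 1).
have sum0 : 0 <= \sum_(N < N0) p n (basis_proj e N x).
  by apply: sumr_ge0 => N _; exact: seminorm_ge0.
exists (Num.bound B) => N; apply: (@le_trans _ _ B); last first.
  apply: ltW; apply: archi_boundP; rewrite /B.
  by have := seminorm_ge0 (pS n) x; lra.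
have [NN0|/N0P /= NN0] := ltnP N N0; last first.
  have := seminormD (pS n) (basis_proj e N x - x) x.
  by rewrite subrK /B; lra.
rewrite /B (bigD1 (Ordinal NN0)) //=.
have : 0 <= \sum_(i < N0 | i != Ordinal NN0) p n (basis_proj e i x).
  by apply: sumr_ge0 => i _; exact: seminorm_ge0.
by have := seminorm_ge0 (pS n) x; lra.
Qed.

(* The p m-ball of radius r * s lies in the closure of the q_n-ball of
   radius s. *)
Lemma basis_proj_almost_open n : exists m r,
  [/\ (n <= m)%N, 0 < r, r <= 1 & forall s x, 0 < s -> p m x < r * s ->
    forall m' eps, 0 < eps ->
      exists2 y, forall N, p n (basis_proj e N y) <= s & p m' (x - y) < eps].
Proof.
pose F (j : nat) := [set x | forall N, p n (basis_proj e N x) <= j%:R].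
have [j [x0 [m [r [r0 dense]]]]] :=
  baire_seminorms pS p_incr pG X_complete (F := F) (basis_proj_bounded n).
have jR : (0 : R) <= j%:R by [].
(* A difference of two points of [F j] has projections of seminorm at most [2 * j%:R], hence below
   [c]; the [+ 1] keeps [c] positive when [j = 0]. *)
pose c : R := 2 * (j%:R + 1).
have c0 : 0 < c by rewrite /c; lra.
(* The maximum and the cap at 1 ensure that a point of the resulting ball is also small for
   [p n]. *)
exists (maxn m n), (Num.min 1 (r / c)); split.
- by rewrite leq_maxr.
- by rewrite lt_min ltr01 divr_gt0.
- by rewrite ge_min lexx.
move=> s x s0 xrs m' eps eps0.
have t0 : 0 < s / c by rewrite divr_gt0.
have xE : x = (s / c) *: ((s / c)^-1 *: x).
  by rewrite scalerA mulfV ?scale1r // gt_eqF.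
set x' := (s / c)^-1 *: x in xE.
have x'r : p m x' < r.
  rewrite (seminormZ (pS m)) gtr0_norm ?invr_gt0 // mulrC ltr_pdivrMr //.
  have -> : r * (s / c) = r / c * s by ring.
  apply: le_lt_trans (seminorms_mono p_incr x (leq_maxl m n)) (lt_le_trans xrs _).
  by rewrite ler_pM2r // ge_min lexx orbT.
have d0 : 0 < eps / 2 / (s / c) by rewrite !divr_gt0.
(* The ball of density is centred at [x0], not at 0: [x' = (x0 + x') - x0] is approximated by a
   difference [z1 - z2] of points of [F j]. *)
have [|z1 z1F z1P] := dense (x0 + x') _ m' _ d0.
  by rewrite addrAC subrr add0r.
have [|z2 z2F z2P] := dense x0 _ m' _ d0.
  by rewrite subrr (seminorm0 (pS m)).
exists ((s / c) *: (z1 - z2)) => [N|].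
  rewrite basis_projZ basis_projB (seminormZ (pS n)) gtr0_norm //.
  have := seminormB (pS n) (basis_proj e N z1) (basis_proj e N z2).
  have := z1F N; have := z2F N => h1 h2 h3.
  rewrite -mulrA mulrC -ler_pdivlMr // divff ?gt_eqF // mulrC ler_pdivrMr //.
  by rewrite mul1r /c; lra.
rewrite {1}xE -scalerBr (seminormZ (pS m')) gtr0_norm // mulrC -ltr_pdivlMr //.
have -> : x' - (z1 - z2) = (z2 - x0) - (z1 - (x0 + x')).
  by rewrite !opprB !addrA subrK [x' + z2]addrC.
apply: le_lt_trans (seminormB (pS m') _ _) _.
rewrite [eps]splitr mulrDl; exact: ltrD.
Qed.

Lemma coordinates_termE k x :
  coordinates e x k *: e k = basis_proj e k.+1 x - basis_proj e k x.
Proof. by rewrite /basis_proj big_ord_recr /= [X in X - _]addrC addrK. Qed.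

(* The sequence w lists the remainders x - (y_0 + ... + y_(i-1)) of the series
   expanding x = w 0. Coordinates converge along the partial sums, and the
   uniform bound in N lets the limits in i and in N be exchanged, so that the
   limiting coordinates are those of x. *)
Lemma basis_proj_remainders n (w : X ^nat) :
  (forall i, p (n + i) (w i) <= 2^-1 ^+ i) ->
  (forall i j, (i <= j)%N -> forall N,
     p (n + i) (basis_proj e N (w i - w j)) <= 2 * 2^-1 ^+ i) ->
  forall N, p n (basis_proj e N (w 0%N)) <= 2.
Proof.
move=> w0 w_cauchy.
(* [y j] is the partial sum of the first j terms, not the j-th term. *)
pose y j := w 0%N - w j.
have yB i j : y j - y i = w i - w j.
  by rewrite /y opprB addrC addrA subrK.
have coordB k x0 x1 : coordinates e (x0 - x1) k = coordinates e x0 k - coordinates e x1 k.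
  by rewrite -scaleN1r [x0 + _]addrC coordinates_linear mulN1r addrC.
have coord_cvg k : exists l : R, coordinates e (y j) k @[j --> \oo] --> l.
  apply/cvg_ex/cauchy_cvgP/cauchy_exP => eps eps0.
  have [m em] := basis_vector_seminorm_gt0 k.
  (* A term is a difference of two consecutive projections, each contributing at most
     [2 * 2^-1 ^+ i]; hence the 4. *)
  have [i iP] : exists i : nat, 2^-1 ^+ i < eps * p m (e k) / 4.
    by apply: half_expr_small; rewrite divr_gt0 // mulr_gt0.
  pose i' := maxn m i.
  exists (coordinates e (y i') k); exists i' => // j /= ij.
  rewrite /ball /= distrC -coordB yB -(ltr_pM2r em) -(seminormZ (pS m)).
  rewrite coordinates_termE; apply: le_lt_trans (seminormB (pS m) _ _) _.
  have mi : (m <= n + i')%N by rewrite (leq_trans (leq_maxl m i)) // leq_addl.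
  have hp N : p m (basis_proj e N (w i' - w j)) <= 2 * 2^-1 ^+ i.
    apply: le_trans (seminorms_mono p_incr _ mi) (le_trans (w_cauchy _ _ ij N) _).
    by rewrite ler_pM2l // ler_wiXn2l ?leq_maxr //; lra.
  by have := hp k; have := hp k.+1; lra.
have [a aP] := choice coord_cvg.
(* Built from the limiting coordinates; that [S N] is the projection of [w 0] follows only from
   [wS]. *)
pose S N := \sum_(k < N) a k *: e k.
have yS N : basis_proj e N (y j) @[j --> \oo] --> S N.
  apply: cvg_big; first exact: add_continuous.
  move=> k _.
  exact: (cvg_comp2 (aP k) (cvg_cst (e k)) (@scale_continuous _ X (a k : R^o, e k))).
have S_near N m i : (m <= n + i)%N ->
    p m (S N - basis_proj e N (y i)) <= 2 * 2^-1 ^+ i.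
  move=> mi; apply: (cvg_seminorm_le pS p_incr pG (yS N)); exists i => // j /= ij.
  rewrite -basis_projB yB.
  exact: le_trans (seminorms_mono p_incr _ mi) (w_cauchy _ _ ij N).
have wS : expands e (w 0%N) a.
  rewrite /expands series_basisE; apply/(cvg_seminormsP p_incr pG) => m eps eps0.
  have [i iP] := @half_expr_small R (eps / 4) ltac:(lra).
  (* [i'] is fixed before [N], which the bound [S_near], uniform in [N], permits. Passing from [S N]
     to [w 0] through the projection of [y i'] and [y i'] itself costs less than [2 + 1 + 1]
     quarters of [eps]. *)
  pose i' := maxn m i.
  have mi : (m <= n + i')%N by rewrite (leq_trans (leq_maxl m i)) // leq_addl.
  have i'i : (2^-1 : R) ^+ i' <= 2^-1 ^+ i by rewrite ler_wiXn2l ?leq_maxr //; lra.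
  near=> N.
  have h1 : p m (basis_proj e N (y i') - y i') < eps / 4.
    near: N; have := @basis_proj_cvg_pointwise (y i').
    by move=> /(cvg_seminormsP p_incr pG); apply; lra.
  have h2 := S_near N _ _ mi.
  have h3 : p m (y i' - w 0%N) <= 2^-1 ^+ i'.
    rewrite /y addrAC subrr add0r (seminormN (pS m)).
    exact: le_trans (seminorms_mono p_incr _ mi) (w0 _).
  have := seminorm_dist (pS m) (basis_proj e N (y i')) (S N) (w 0%N).
  have := seminorm_dist (pS m) (y i') (basis_proj e N (y i')) (w 0%N).
  by rewrite -/(S N); lra.
(* At index 0 the partial sum is 0, so [S_near] bounds [S N] itself by 2. *)
move=> N; have := @S_near N n 0%N; rewrite addn0 leqnn => /(_ isT).
rewrite /y subrr basis_proj0 subr0 expr0 mulr1; apply: le_trans.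
by rewrite /basis_proj (coordinates_unique wS).
Unshelve. all: by end_near. Qed.

(** Almost openness is iterated: each remainder is approximated by a vector with controlled
    projections, leaving a remainder small enough for the next seminorm. The geometric series bounds
    the projections by 2, and homogeneity gives any [eps]. *)
Lemma basis_proj_equicontinuous n eps : 0 < eps ->
  exists m r, 0 < r /\ forall x, p m x < r -> forall N, p n (basis_proj e N x) <= eps.
Proof.
have base k : exists mr : nat * R, [/\ (k <= mr.1)%N, 0 < mr.2, mr.2 <= 1 &
    forall s x, 0 < s -> p mr.1 x < mr.2 * s -> forall m' d, 0 < d ->
      exists2 y, forall N, p k (basis_proj e N y) <= s & p m' (x - y) < d].
  by have [m [r mrP]] := basis_proj_almost_open k; exists (m, r).
have [mr mrP] := choice base.
pose m k := (mr k).1; pose r k := (mr k).2.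
have h0 i : (0 : R) < 2^-1 ^+ i by apply: exprn_gt0; lra.
have le2 x : p (m n) x < r n -> forall N, p n (basis_proj e N x) <= 2.
  move=> xr.
  have step (iw : nat * X) : exists w', let: (i, w) := iw in
      p (m (n + i)%N) w < r (n + i)%N * 2^-1 ^+ i ->
      p (m (n + i.+1)%N) w' < r (n + i.+1)%N * 2^-1 ^+ i.+1 /\
      forall N, p (n + i) (basis_proj e N (w - w')) <= 2^-1 ^+ i.
    case: iw => i w.
    (* Outside the ball the implication is void and 0 is a default value. *)
    case: (ltP (p (m (n + i)%N) w) (r (n + i)%N * 2^-1 ^+ i)) => [wr|_]; last by exists 0.
    have [_ _ _ /(_ _ _ (h0 i) wr)] := mrP (n + i)%N.
    have [_ r0 _ _] := mrP (n + i.+1)%N.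
    move=> /(_ (m (n + i.+1)%N) _ (mulr_gt0 r0 (h0 i.+1)))[y yP wy].
    by exists (w - y) => _; split=> // N; rewrite opprB addrC subrK.
  have [g gP] := choice step.
  pose w := fix w i := if i is i'.+1 then g (i', w i') else x.
  have wr i : p (m (n + i)%N) (w i) < r (n + i)%N * 2^-1 ^+ i.
    elim: i => [|i /(gP (i, w i))[]//]; by rewrite addn0 expr0 mulr1.
  apply: (@basis_proj_remainders n w) => [i|i j /subnKC <-].
    have [nm _ r1 _] := mrP (n + i)%N.
    apply: le_trans (seminorms_mono p_incr _ nm) (le_trans (ltW (wr i)) _).
    by rewrite ler_piMl // ltW.
  (* The induction closes because 2^-i + 2 * 2^-(i+1) = 2 * 2^-i, the tail bound in [p (n + i.+1)]
     passing down to [p (n + i)]. *)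
  move: (j - i)%N => d N; elim: d i => [|d IH] i.
    by rewrite addn0 subrr basis_proj0 (seminorm0 (pS _)) mulr_ge0 // ltW.
  have [_ /(_ N)] := gP (i, w i) (wr i); rewrite -/(w i.+1) => h1.
  have := IH i.+1; rewrite addSnnS exprS => h2.
  have h3 := @seminorms_mono _ _ p p_incr (n + i) (n + i.+1)
    (basis_proj e N (w i.+1 - w (i + d.+1)%N)) ltac:(by rewrite addnS).
  have := seminormD (pS (n + i)%N) (basis_proj e N (w i - w i.+1))
    (basis_proj e N (w i.+1 - w (i + d.+1)%N)).
  by rewrite -basis_projD addrA subrK; lra.
move=> eps0; have [_ r0 _ _] := mrP n.
(* Scaling by [(eps / 2)^-1] turns the bound 2 into [eps]. *)
exists (m n), (r n * (eps / 2)); split; first by rewrite mulr_gt0 // divr_gt0.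
move=> x xr N.
have e2 : 0 < eps / 2 by lra.
have := le2 ((eps / 2)^-1 *: x) _ N.
rewrite basis_projZ !(seminormZ (pS _)) gtr0_norm ?invr_gt0 // mulrC ltr_pdivrMr //.
by move=> /(_ xr); rewrite mulrC ler_pdivrMr //; lra.
Qed.

(** Split Pi_N y - x as Pi_N (y - x) + (Pi_N x - x): equicontinuity handles the first summand,
    pointwise convergence the second. *)
Lemma basis_proj_cvg {I : Type} {F : set_system I} {FF : Filter F}
    (N : I -> nat) (y : I -> X) (x : X) :
  N @ F --> \oo -> y @ F --> x -> basis_proj e (N i) (y i) @[i --> F] --> x.
Proof.
move=> Noo yx; apply/(cvg_seminormsP p_incr pG) => n eps eps0.
have e2 : 0 < eps / 2 by lra.
have [m [r [r0 mr]]] := basis_proj_equicontinuous n e2.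
near=> i.
have h1 : p n (basis_proj e (N i) (y i - x)) <= eps / 2.
  by apply: mr; near: i; move/(cvg_seminormsP p_incr pG): yx; apply.
have h2 : p n (basis_proj e (N i) x - x) < eps / 2.
  near: i; apply: (Noo [set k | p n (basis_proj e k x - x) < eps / 2]).
  have /(cvg_seminormsP p_incr pG) := @basis_proj_cvg_pointwise x.
  by apply; lra.
have := seminorm_dist (pS n) (basis_proj e (N i) x) (basis_proj e (N i) (y i)) x.
by rewrite -basis_projB; lra.
Unshelve. all: by end_near. Qed.

End SchauderBasis.

(** * Uniform convergence on compact sets *)

(** Joint convergence gives the estimate for all (y, N) near (x, oo); finitely many such
    neighbourhoods cover [K] and share a threshold for [N]. *)
Lemma compact_cvg_uniform {R : realType} {T : topologicalType} {K : set T}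
    (g : T -> R) (G : nat -> T -> R) (eps : R) :
  compact K -> (forall x, K x -> {for x, continuous g}) ->
  (forall x, K x -> G z.2 z.1 @[z --> (nbhs x, \oo)] --> g x) -> 0 < eps ->
  exists N0, forall N, (N0 <= N)%N -> forall x, K x -> `|g x - G N x| < eps.
Proof.
move=> /compact_near_coveringP Kcov gc Gg eps0.
have [|N0 _ N0P] := Kcov _ \oo (fun N x => `|g x - G N x| < eps); last first.
  by exists N0 => N /N0P; exact.
move=> x Kx.
have gx : g z.1 @[z --> (nbhs x, \oo)] --> g x.
  by apply: (cvg_comp _ _ (cvg_fst (F := nbhs x) (G := \oo))); exact: gc.
have /cvgrPdist_lt/(_ _ eps0) : g z.1 - G z.2 z.1 @[z --> (nbhs x, \oo)] --> (0 : R).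
  by rewrite -(subrr (g x)); exact: cvgB gx (Gg x Kx).
by apply: filterS => -[y N] /=; rewrite sub0r normrN.
Qed.

(** * Stability of the network under projection *)

Unset Implicit Arguments.
Set Strict Implicit.

(* N_* is chosen before f and epsilon: it depends on them only through the
   network. *)
Theorem theorem4p3 (R : realType) (X : tvsType R) (p : nat -> X -> R)
    (e : nat -> X) (sigma : X -> X) (K : set X)
    (M : nat) (l : 'I_M -> {linear X -> R^o}) (A : 'I_M -> {linear X -> X})
    (b : 'I_M -> X) (delta : R) :
  frechet_space X -> separable X ->
  (forall k, seminorm (p k)) ->
  (forall k x, p k x <= p k.+1 x) ->
  generates_topology p ->
  schauder_basis e ->
  (exists k0, forall k, (k0 <= k)%N ->
     exists C : R, 0 <= C /\
       forall x y, p k (sigma x - sigma y) <= C * p k (x - y)) ->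
  compact K ->
  (forall j, continuous (l j)) ->
  (forall j, continuous (A j)) ->
  0 < delta ->
  exists Nstar : nat, forall (f : X -> R) (eps : R),
    continuous f -> 0 < eps ->
    (ereal_sup [set (`|f x - \sum_(j < M) l j (sigma (A j x + b j))|)%:E
               | x in K] < eps%:E)%E ->
    forall N, (Nstar <= N)%N ->
      (ereal_sup
        [set (`|f x - \sum_(j < M)
                 l j (basis_proj e N
                   (sigma (basis_proj e N (A j (basis_proj e N x)) + basis_proj e N (b j))))|)%:E
        | x in K] < (eps + delta)%:E)%E.
Proof.
move=> [_ _ X_complete] _ pS p_incr pG eB sigmaL Kcompact l_cont A_cont delta0.
have sigma_cont := seminorm_lipschitz_continuous pS p_incr pG sigmaL.
have proj_cvg := @basis_proj_cvg R X p e pS p_incr pG X_complete eB.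
have add_cvg (I : Type) (F : set_system I) (FF : Filter F) (u v : I -> X) x y :
    u @ F --> x -> v @ F --> y -> u i + v i @[i --> F] --> x + y.
  by move=> ux vy; exact: (cvg_comp2 ux vy (@add_continuous X (x, y))).
have [|||N0 N0P] := compact_cvg_uniform
  (g := fun x => \sum_(j < M) l j (sigma (A j x + b j)))
  (G := fun N x => \sum_(j < M) l j (basis_proj e N
          (sigma (basis_proj e N (A j (basis_proj e N x)) + basis_proj e N (b j)))))
  (eps := delta / 2) Kcompact.
- move=> x _; apply: cvg_big => [|j _]; first exact: add_continuous.
  apply: (continuous_cvg _ (l_cont j _)); apply: (continuous_cvg _ (sigma_cont _)).
  by apply: (add_cvg); [exact: A_cont|exact: cvg_cst].
- move=> x _; apply: cvg_big => [|j _]; first exact: add_continuous.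
  have Noo : z.2 @[z --> (nbhs x, \oo)] --> \oo by exact: cvg_snd.
  have zx : z.1 @[z --> (nbhs x, \oo)] --> x by exact: cvg_fst.
  (* The layers are peeled from the outside in; joint convergence is what allows each projection to
     act on an argument that itself depends on [N]. *)
  apply: (continuous_cvg _ (l_cont j _)); apply: (proj_cvg) => //.
  apply: (continuous_cvg _ (sigma_cont _)).
  apply: (add_cvg); apply: (proj_cvg) => //; last exact: cvg_cst.
  by apply: (continuous_cvg _ (A_cont j _)); exact: (proj_cvg).
- by rewrite divr_gt0.
exists N0 => f eps _ _ f_eps N /N0P NP.
apply: (@le_lt_trans _ _ (eps + delta / 2)%:E); last by rewrite lte_fin; lra.
apply: ge_ereal_sup => _ [x Kx <-]; rewrite lee_fin.
have fx : `|f x - \sum_(j < M) l j (sigma (A j x + b j))| < eps.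
  rewrite -lte_fin; apply: le_lt_trans f_eps.
  by apply: ereal_sup_ubound; exists x.
rewrite -(subrKA (\sum_(j < M) l j (sigma (A j x + b j)))).
apply: le_trans (ler_normD _ _) _.
by apply: lerD; apply: ltW => //; exact: NP.
Qed.
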